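(* Let $G$ be a finite group such that the difference subgroup graph $D(G)$ is a cograph. Then $G$ is solvable.
   Context: For a finite group $G$, the difference subgroup graph $D(G)$ is the undirected graph whose vertices are the non-trivial proper subgroups of $G$, with two distinct vertices $H$ and $K$ adjacent if and only if $\langle H,K\rangle = G$ and $HK\neq G$, where $HK=\{hk : h\in H,\ k\in K\}$. A graph is a cograph if it has no induced subgraph isomorphic to the path $P_4$ on four vertices. *)

(* Defs.v *)
From mathcomp Require Import all_boot all_fingroup all_solvable.

Set Implicit Arguments.
Unset Strict Implicit.
Unset Printing Implicit Defensive.

Local Open Scope group_scope.

Definition path_graph (n : nat) : rel 'I_n :=
  fun i j => (i.+1 == j :> nat) || (j.+1 == i :> nat).

(* An injective map preserving and reflecting adjacency is an isomorphism of
   the source onto the subgraph induced on its image. *)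
Definition induced_embedding (S T : finType) (d : rel S) (e : rel T)
    (f : S -> T) : Prop :=
  injective f /\ forall x y : S, e (f x) (f y) = d x y.

Definition cograph (T : finType) (e : rel T) : Prop :=
  ~ exists f : 'I_4 -> T, induced_embedding (@path_graph 4) e f.

Definition nontrivial_proper_subgroup (gT : finGroupType) (G : {group gT}) :=
  {H : {group gT} | (H :!=: 1) && (H \proper G)}.

(* H * K is the product set of H and K, which need not be a subgroup. *)
Definition difference_subgroup_graph (gT : finGroupType) (G : {group gT}) :
    rel (nontrivial_proper_subgroup G) :=
  fun H K => [&& H != K,
                 << val H :|: val K >> == G :> {set gT} &
                 val H * val K != G :> {set gT}].

Lemma difference_subgroup_graph_irr (gT : finGroupType) (G : {group gT}) :
  irreflexive (@difference_subgroup_graph gT G).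
Proof. by move=> H; rewrite /difference_subgroup_graph eqxx. Qed.

Lemma difference_subgroup_graph_sym (gT : finGroupType) (G : {group gT}) :
  symmetric (@difference_subgroup_graph gT G).
Proof.
move=> H K; rewrite /difference_subgroup_graph eq_sym setUC; congr [&& _, _ & ~~ _].
by rewrite -(inj_eq invg_inj) invMg !invGid.
Qed.

(* Main.v *)
Require Import Defs.
From mathcomp Require Import all_boot all_fingroup all_solvable vcharacter.

(** Cographs pass to quotients, so take N minimal normal in G with G/N solvable,
    P a non-trivial Sylow subgroup of N that is not normal in G, and a maximal
    subgroup M containing N_G(P). By the Frattini argument M does not contain N,
    and if M contains a non-trivial normal subgroup C of G, then N embeds in G/C.
    Suppose M is core-free. If M1, M2 are conjugates of M with x in M1 \ M2 and
    y in M2 \ M1, and x, y lie in a common conjugate of M, then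
    <x> - M2 - M1 - <y> is an induced P4: distinct conjugates of M never factorize
    G. Hence the sets S(x) of conjugates of M through x, for x in M, form a chain,
    and so M, which preserves their sizes, stabilizes each S(x). If S(x) contains
    two conjugates, both stabilize S(x), hence so does G, and x lies in the core.
    So M meets its other conjugates trivially and G is a Frobenius group with some
    kernel K. As P <= M, N is not contained in K, so N embeds in the solvable
    group G/K. *)

Set Implicit Arguments.
Unset Strict Implicit.
Unset Printing Implicit Defensive.

Local Open Scope group_scope.

Lemma path4_not_cograph (T : finType) (e : rel T) (a b c d : T) :
  irreflexive e -> symmetric e ->
  e a b -> e b c -> e c d -> ~~ e a c -> ~~ e b d -> ~~ e a d ->
  ~ cograph e.
Proof.
move=> e_irr e_sym eab ebc ecd eac ebd ead; apply.
exists (tnth [tuple a; b; c; d]).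
have eP (i j : 'I_4) :
    e (tnth [tuple a; b; c; d] i) (tnth [tuple a; b; c; d] j) = path_graph i j.
  case: i j => [[|[|[|[|i]]]] lti] [[|[|[|[|j]]]] ltj] //;
    rewrite /path_graph !(tnth_nth a) /= ?e_irr //;
    by rewrite ?eab ?ebc ?ecd ?(negPf eac) ?(negPf ebd) ?(negPf ead) // e_sym
               ?eab ?ebc ?ecd ?(negPf eac) ?(negPf ebd) ?(negPf ead).
split=> // i j eq_ij; apply/val_inj.
(* Distinct vertices of the path have distinct neighbourhoods. *)
have nbr k (ltk4 : k < 4) :
    path_graph i (Ordinal ltk4) = path_graph j (Ordinal ltk4).
  by rewrite -!eP eq_ij.
have := nbr 0%N isT; have := nbr 1%N isT; have := nbr 2%N isT; have := nbr 3%N isT.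
by clear; case: i j => [[|[|[|[|i]]]] lti] [[|[|[|[|j]]]] ltj].
Qed.

Section DifferenceSubgroupGraph.

Variables (gT : finGroupType) (G : {group gT}).
Implicit Types H K L M N : {group gT}.

Let vertex := nontrivial_proper_subgroup G.
Let adj := @difference_subgroup_graph gT G.

(** * Passage to quotients *)

Lemma cosetpre_vertex N (K : nontrivial_proper_subgroup (G / N)%G) :
    N <| G ->
  ((coset N @*^-1 val K)%G :!=: 1) && ((coset N @*^-1 val K)%G \proper G).
Proof.
move=> nNG; have /andP[ntK prK] := valP K.
rewrite -[in X in _ && X](quotientGK nNG) cosetpre_proper prK andbT.
by apply: contraNneq ntK => K1; rewrite -(cosetpreK (val K)) K1 quotient1.
Qed.

(** Taking preimages under [coset N] is injective, commutes with joins and products, and sends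
    [G / N] to [G], so D(G/N) is an induced subgraph of D(G). *)
Lemma cograph_quotient N :
  N <| G -> cograph adj -> cograph (@difference_subgroup_graph _ (G / N)%G).
Proof.
move=> nNG cogG [f [f_inj f_adj]]; apply: cogG.
pose lft (K : nontrivial_proper_subgroup (G / N)%G) : vertex :=
  Sub (coset N @*^-1 val K)%G (cosetpre_vertex K nNG).
have pre_inj : injective (fun C : {set coset_of N} => coset N @*^-1 C).
  by apply: can_inj (fun A : {set gT} => A / N) _; apply: cosetpreK.
have lft_inj : injective lft.
  by move=> H K /(congr1 val)/(congr1 val)/= /pre_inj/val_inj/val_inj.
have preG (C : {set coset_of N}) : (coset N @*^-1 C == G) = (C == G / N).
  by rewrite -(inj_eq pre_inj) /= quotientGK.
exists (lft \o f); split=> [|i j]; first exact: inj_comp.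
rewrite -f_adj /adj /difference_subgroup_graph (inj_eq lft_inj) /=.
congr [&& _, _ & ~~ _].
  by rewrite -morphpreU -cosetpre_gen ?preG // inE group1.
by rewrite -cosetpreM preG.
Qed.

(** * Conjugates of a maximal subgroup *)

Lemma conj_mul_neq M (g : gT) : M \proper G -> g \in G -> M * M :^ g != G.
Proof.
move=> prM Gg; apply: contraTneq prM => defG.
have: g \in M * M :^ g by rewrite defG.
case/mulsgP=> u _ Mu /imsetP[v Mv ->] g_uv.
(* From g = u (g^-1 v g) one gets u g^-1 v = 1, so g = v u lies in M; then [M * M :^ g] collapses to
   M. *)
have Mg: g \in M.
  have: u * g^-1 * v = 1 by apply: (mulIg g); rewrite mul1g {3}g_uv /conjg !mulgA.
  move/(canRL (mulgK v))/(canRL (mulKg u)) => g_inv.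
  by rewrite -groupV g_inv mul1g groupM ?groupV.
by rewrite -defG conjGid // mulGid properxx.
Qed.

Lemma maximal_gen M (A : {set gT}) :
  maximal M G -> A \subset G -> ~~ (A \subset M) -> << A :|: M >> = G.
Proof.
case/maxgroupP=> prM maxM sAG nsAM.
apply: contraNeq nsAM => neG.
have sAMG : << A :|: M >> \subset G by rewrite gen_subG subUset sAG proper_sub.
rewrite -(maxM _ _ (subset_trans (subsetUr A M) (subset_gen _))) ?properEneq ?neG //.
exact: subset_trans (subsetUl A M) (subset_gen _).
Qed.

Definition conjugates_through M (x : gT) : {set {group gT}} :=
  [set L in orbit 'JG%act G M | x \in L].

Lemma maximal_orbitJG M L : maximal M G -> L \in orbit 'JG%act G M -> maximal L G.
Proof.
move=> maxM /orbitP[g Gg <-] /=.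
by rewrite -(conjGid Gg) maximalJ.
Qed.

Lemma conjugates_through_chain M (x y : gT) :
    cograph adj -> maximal M G -> x \in M -> y \in M ->
  (conjugates_through M x \subset conjugates_through M y)
  || (conjugates_through M y \subset conjugates_through M x).
Proof.
move=> cogG maxM Mx My; apply/negPn/negP; rewrite negb_or.
case/andP=> /subsetPn[L1]; rewrite !inE => /andP[O1 L1x]; rewrite O1 /= => L1'y.
case/subsetPn=> L2; rewrite !inE => /andP[O2 L2y]; rewrite O2 /= => L2'x.
have [max1 max2] := (maximal_orbitJG maxM O1, maximal_orbitJG maxM O2).
have [[prM pr1] pr2] := (maxgroupp maxM, maxgroupp max1, maxgroupp max2).
have sxM : <[x]> \subset M by rewrite cycle_subG.
have syM : <[y]> \subset M by rewrite cycle_subG.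
have sx1 : <[x]> \subset L1 by rewrite cycle_subG.
have sy2 : <[y]> \subset L2 by rewrite cycle_subG.
have nsx2 : ~~ (<[x]> \subset L2) by rewrite cycle_subG.
have nsy1 : ~~ (<[y]> \subset L1) by rewrite cycle_subG.
have nt (H K : {group gT}) : ~~ (H \subset K) -> H :!=: 1.
  by apply: contraNneq => ->; apply: sub1G.
have ns12 : ~~ (L1 \subset L2) by apply: contra L2'x => /subsetP->.
have ns21 : ~~ (L2 \subset L1) by apply: contra L1'y => /subsetP->.
have mk (H K : {group gT}) : ~~ (H \subset K) -> H \proper G ->
    (H :!=: 1) && (H \proper G).
  by move=> /nt-> ->.
pose X : vertex := Sub <[x]>%G (mk _ _ nsx2 (sub_proper_trans sxM prM)).
pose Y : vertex := Sub <[y]>%G (mk _ _ nsy1 (sub_proper_trans syM prM)).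
pose V1 : vertex := Sub L1 (mk _ _ ns12 pr1).
pose V2 : vertex := Sub L2 (mk _ _ ns21 pr2).
have mul_neq K H : K \in orbit 'JG%act G M -> H \in orbit 'JG%act G M ->
    K * H != G.
  move=> OK OH; have: H \in orbit 'JG%act G K by rewrite (orbit_eqP OK).
  by case/orbitP=> g Gg <-; rewrite conj_mul_neq ?(maxgroupp (maximal_orbitJG maxM OK)).
(* If A H = G with A inside K, then K H = G as well, which is excluded for conjugates. *)
have mul_sub_neq K H (A : {set gT}) :
    K \in orbit 'JG%act G M -> H \in orbit 'JG%act G M ->
    A \subset K -> A * H != G.
  move=> OK OH sAK; apply: contraNneq (mul_neq _ _ OK OH) => defG.
  rewrite eqEsubset -{2}defG mulSg // mul_subG ?proper_sub //.
  - exact: maxgroupp (maximal_orbitJG maxM OK).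
  - exact: maxgroupp (maximal_orbitJG maxM OH).
have adjP (H K : vertex) : ~~ (val H \subset val K) -> maximal (val K) G ->
    val H * val K != G -> adj H K.
  move=> nsHK maxK HK; apply/and3P; split=> //.
    by apply: contraNneq nsHK => ->.
  by rewrite maximal_gen // proper_sub //; case/andP: (valP H).
have nadjP (H K : vertex) L :
    val H \subset L -> val K \subset L -> L \proper G -> ~~ adj H K.
  move=> sHL sKL prL; apply/and3P=> -[_ /eqP genG _].
  by move: prL; rewrite -genG properE gen_subG subUset sHL sKL andbF.
(* The three non-edges hold because each pair lies in a common proper subgroup: x is in L1, y is in
   L2, and both are in M. *)
apply: (@path4_not_cograph _ adj X V2 V1 Y) cogG.
- exact: difference_subgroup_graph_irr.
- exact: difference_subgroup_graph_sym.
- by apply: adjP => //; apply: mul_sub_neq O1 O2 sx1.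
- by apply: adjP => //; apply: mul_neq.
- rewrite [adj _ _]difference_subgroup_graph_sym; apply: adjP => //.
  exact: mul_sub_neq O2 O1 sy2.
- exact: (nadjP X V1 L1).
- exact: (nadjP V2 Y L2).
- exact: (nadjP X Y M).
Qed.

(** For g in M, S(x^g) is the g-conjugate of S(x), hence of the same size; both x and x^g lie in M,
    so the two sets are comparable and therefore equal. *)
Lemma conjugates_through_stable M (x : gT) :
    cograph adj -> maximal M G -> x \in M ->
  M \subset 'N(conjugates_through M x | 'JG).
Proof.
move=> cogG maxM Mx; apply/subsetP=> g Mg.
have sMG : M \subset G by apply: proper_sub (maxgroupp maxM).
have defS : conjugates_through M (x ^ g) =
    [set (L :^ g)%G | L in conjugates_through M x].
  apply/setP=> L; have ->: L = ((L :^ g^-1) :^ g)%G.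
    by apply: val_inj; rewrite /= conjsgKV.
  move: (L :^ g^-1)%G => K.
  rewrite (mem_imset _ _ (act_inj 'JG%act g)) !inE /= memJ_conjg.
  by rewrite (actsP (acts_orbit 'JG%act M (subsetT G))) ?(subsetP sMG).
have eqS : conjugates_through M (x ^ g) = conjugates_through M x.
  have eq_card : #|conjugates_through M (x ^ g)| = #|conjugates_through M x|.
    by rewrite defS card_imset //; apply: (act_inj 'JG%act g).
  have Mxg : x ^ g \in M by rewrite groupJ.
  case/orP: (conjugates_through_chain cogG maxM Mx Mxg) => sS.
    by apply/eqP; rewrite eq_sym eqEcard sS eq_card /=.
  by apply/eqP; rewrite eqEcard sS eq_card /=.
apply/astabsP=> L; rewrite -[in LHS]eqS defS /=.
exact: (mem_imset _ _ (act_inj 'JG%act g)).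
Qed.

(** If g were outside M, then M and L = M^(g^-1) would be distinct maximal subgroups through x.
    Being conjugate, they define the same S(x), so both stabilize it, and so does the group G they
    generate. *)
Lemma corefree_maximal_TI M (x g : gT) :
    cograph adj -> maximal M G -> gcore M G = 1 -> g \in G ->
  x \in M -> x ^ g \in M -> x != 1 -> g \in M.
Proof.
move=> cogG maxM core1 Gg Mx Mxg nt_x.
have core'x : x \notin gcore M G by rewrite core1 inE.
apply: contraR (core'x) => M'g.
have prM : M \proper G := maxgroupp maxM.
pose L := (M :^ g^-1)%G.
have OL : L \in orbit 'JG%act G M by apply: mem_orbit; rewrite groupV.
have maxL := maximal_orbitJG maxM OL.
have Lx : x \in L by rewrite /= mem_conjgV.
have defS : conjugates_through L x = conjugates_through M x.
  by apply/setP=> K; rewrite !inE (orbit_eqP OL).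
(* Otherwise g normalizes M; as g is outside the maximal M, M is normal in G and equals its core,
   which then contains x. *)
have nsLM : ~~ (L \subset M).
  apply: contra core'x => sLM.
  have nMg : g \in 'N(M).
    rewrite -groupV; apply/normP/eqP.
    by rewrite eqEcard sLM cardJg leqnn.
  have sMC : M \subset gcore M G.
    apply: gcore_max => //.
    rewrite -(maximal_gen maxM _ (_ : ~~ ([set g] \subset M))) ?sub1set //.
    by rewrite gen_subG subUset sub1set nMg normG.
  exact: subsetP sMC x Mx.
have actsG : G \subset 'N(conjugates_through M x | 'JG).
  rewrite -(maximal_gen maxM (proper_sub (maxgroupp maxL)) nsLM) gen_subG subUset.
  by rewrite -{1}defS !conjugates_through_stable.
(* M belongs to the G-stable set S(x), so every conjugate of M contains x. *)
apply/bigcapP=> h Gh.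
have /astabsP/(_ M) := subsetP actsG h Gh.
by rewrite !inE /= orbit_refl Mx => /andP[].
Qed.

Lemma corefree_maximal_Frobenius M :
    cograph adj -> maximal M G -> M :!=: 1 -> gcore M G = 1 ->
  [Frobenius G with complement M].
Proof.
move=> cogG maxM ntM core1; have prM : M \proper G := maxgroupp maxM.
apply/andP; split; first by rewrite proper_neq.
apply/normedTI_memJ_P; split; [by rewrite setD_eq0 subG1 | exact: proper_sub |].
move=> x g /setD1P[nt_x Mx] Gg; rewrite !inE conjg_eq1 nt_x /=.
apply/idP/idP=> [Mxg | Mg]; last by rewrite groupJ.
exact: corefree_maximal_TI Mx Mxg nt_x.
Qed.

End DifferenceSubgroupGraph.

(** * Solvability by induction on the order *)

Lemma solvable_TI_normal (gT : finGroupType) (G N K : {group gT}) :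
  N <| G -> K <| G -> N :&: K = 1 -> solvable (G / K) -> solvable N.
Proof.
move=> /andP[sNG _] /andP[_ nKG] tiNK solGK.
rewrite (isog_sol (quotient_isog (subset_trans sNG nKG) _)) 1?setIC //.
exact: solvableS (quotientS K sNG) solGK.
Qed.

Theorem theorem4p2 (gT : finGroupType) (G : {group gT}) :
  cograph (@difference_subgroup_graph gT G) -> solvable G.
Proof.
have [n] := ubnP #|G|; elim: n gT G => // n IHn gT G leGn cogG.
have [-> | ntG] := eqsVneq G 1; first exact: solvable1.
have IHq (K : {group gT}) : K <| G -> K :!=: 1 -> solvable (G / K).
  move=> nKG ntK; apply: IHn (cograph_quotient nKG cogG).
  exact: leq_trans (ltn_quotient ntK (normal_sub nKG)) leGn.
have [N minN sNG] := minnormal_exists ntG (normG G).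
have [/andP[ntN nNG] min_N] := mingroupP minN.
have nsNG : N <| G by apply/andP.
have TI_or_sub (K : {group gT}) : K <| G -> N :&: K = 1 \/ N \subset K.
  move=> /andP[_ nKG]; have [-> | ntNK] := eqVneq (N :&: K) 1; [by left | right].
  rewrite -(min_N (N :&: K)%G) ?subsetIl ?subsetIr //.
  by rewrite ntNK normsI.
have solTI (K : {group gT}) : K <| G -> K :!=: 1 -> N :&: K = 1 -> solvable G.
  move=> nKG ntK tiNK; rewrite (series_sol nsNG) IHq // andbT.
  exact: solvable_TI_normal tiNK (IHq _ nKG ntK).
pose p := pdiv #|N|; have [P sylP] := Sylow_exists p N.
have [sPN pP _] := and3P sylP.
have ntP : P :!=: 1.
  by rewrite -rank_gt0 (rank_Sylow sylP) p_rank_gt0 pi_pdiv cardG_gt1.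
have [nPG | not_nPG] := boolP (G \subset 'N(P)).
  (* If P is normal in G, minimality makes N a p-group. *)
  have defN : P :=: N by rewrite (min_N P) // ntP.
  by rewrite (series_sol nsNG) IHq // andbT -defN (pgroup_sol pP).
have defG : N * 'N_G(P) = G := Frattini_arg nsNG sylP.
have [NG | [M maxM sNM]] := maximal_exists (subsetIl G 'N(P)).
  by case/negP: not_nPG; rewrite -NG subsetIr.
have prM : M \proper G := maxgroupp maxM.
have sPM : P \subset M.
  by apply: subset_trans sNM; rewrite subsetI normG (subset_trans sPN).
have nsNM : ~~ (N \subset M).
  apply: contraL prM => sNM'; rewrite properE negb_and negbK; apply/orP; right.
  by rewrite -defG mul_subG.
have nsCG : gcore M G <| G by rewrite gcore_normal ?proper_sub.
have [core1 | ntC] := eqVneq (gcore M G) 1; last first.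
  have [tiNC | sNC] := TI_or_sub [group of gcore M G] nsCG.
    exact: solTI ntC tiNC.
  by case/negP: nsNM; apply: subset_trans sNC (gcore_sub M G).
have ntM : M :!=: 1 by apply: contraNneq ntP => M1; rewrite -subG1 -M1.
have frobG := corefree_maximal_Frobenius cogG maxM ntM core1.
(* Frobenius's theorem, from character theory, provides the normal complement K of M. *)
have [K frobK] := Frobenius_kernel_exists frobG.
have [defKM ntK _ _ _] := Frobenius_context frobK.
have [nsKG _ _ _ tiKM] := sdprod_context defKM.
have [tiNK | sNK] := TI_or_sub K nsKG; first exact: solTI ntK tiNK.
(* If N were inside K, then P would lie in the trivial intersection of K and M. *)
case/negP: ntP; rewrite -subG1 -tiKM subsetI sPM andbT.
exact: subset_trans sPN sNK.
Qed.
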